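(* Let $p\ge3$ and $\lambda=\lambda_p=2\cos(\pi/p)$. Suppose $\mathcal A$ is a hyperbolic equivalence class of $\lambda$-BQFs with associated ISP $P_{\mathcal A}$, and let $W$ be a product of conjugacy class generators representing the corresponding primitive hyperbolic conjugacy class (the class of elements $M$ with $Q_M\in\mathcal A$). The following are equivalent: (a) $P_{\mathcal A}$ has Hecke-symmetry, i.e. $P_{\mathcal A}'=P_{\mathcal A}$; (b) $\mathcal M_{\mathcal A}^{\top}=\mathcal M_{\mathcal A}$; (c) $W^{\top}\sim W$ (conjugate in $G_p$); (d) $W^{\top}$ is a cyclic permutation of $W$, where for $W=V_{j_1}\cdots V_{j_n}$ one has $W^{\top}=V_{p-j_n}\cdots V_{p-j_1}$.
   Context: Let $S=\begin{pmatrix}1&\lambda\\0&1\end{pmatrix}$, $T=\begin{pmatrix}0&-1\\1&0\end{pmatrix}$, $U=ST$, $G_p=\langle S,T\rangle/\{\pm I\}$ acting by Möbius transformations; elements represented by matrices of positive trace; hyperbolic: $|\mathrm{tr}|>2$; primitive: not a $k$-th power, $k\ge2$. Conjugacy class generators: $V_j=U^{j-1}S$, $1\le j\le p-1$; every non-elliptic element is conjugate to a product of $V_j$'s unique up to cyclic permutation. A hyperbolic number is a fixed point of a hyperbolic element; its Hecke-conjugate $\alpha'$ is the other fixed point; $R'=\{x':x\in R\}$. A $\lambda$-BQF is $Ax^2+Bxy+Cy^2$ with coefficients in $\mathbb Z[\lambda]$, with $G_p$-action $(Q\circ M)(x,y)=Q(ax+by,cx+dy)$ and induced equivalence. For primitive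 hyperbolic $M=\begin{pmatrix}a&b\\c&d\end{pmatrix}$ of positive trace, $Q_M=[c,d-a,-b]$; for hyperbolic $\alpha$, $M_\alpha$ is the primitive hyperbolic element with attracting fixed point $\alpha$ and $Q_\alpha=Q_{M_\alpha}$. $\alpha$ is simple if $\alpha'<0<\alpha$. For a class $\mathcal A$: $\mathcal Z_{\mathcal A}=\{\alpha\text{ simple}:Q_\alpha\in\mathcal A\}$; the ISP (irreducible system of poles of rational period functions on $G_p$) is $P_{\mathcal A}=\mathcal Z_{\mathcal A}\cup T\mathcal Z_{\mathcal A}$; $\mathcal M_{\mathcal A}=\{M_\alpha:\alpha\in\mathcal Z_{\mathcal A}\}$ and $\mathcal M_{\mathcal A}^{\top}=\{M^{\top}:M\in\mathcal M_{\mathcal A}\}$. *)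

(* Defs.v *)
From mathcomp Require Import all_boot all_order all_algebra.
From mathcomp Require Import ring.
From mathcomp Require Import all_classical all_reals all_analysis.

Set Implicit Arguments.
Unset Strict Implicit.
Unset Printing Implicit Defensive.

Import Order.TTheory GRing.Theory Num.Theory.
Import numFieldNormedType.Exports.

Local Open Scope classical_set_scope.
Local Open Scope ring_scope.

Definition mx2 (R : realType) (a b c d : R) : 'M[R]_2 :=
  \matrix_(i < 2, j < 2)
    (if i == 0 then (if j == 0 then a else b) else (if j == 0 then c else d)).

Definition lambda (R : realType) (p : nat) : R := 2 * cos (pi / p%:R).

Definition heckeS (R : realType) (p : nat) : 'M[R]_2 := mx2 1 (lambda R p) 0 1.
Definition heckeT (R : realType) : 'M[R]_2 := mx2 0 (-1) 1 0.
Definition heckeU (R : realType) (p : nat) : 'M[R]_2 := heckeS R p *m heckeT R.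

(* The matrix group <S, T>.  The Hecke group G_p is its quotient by {I, -I}:
   elements of G_p are given by matrices of <S, T>, compared with [projeq]. *)
Inductive heckeG (R : realType) (p : nat) : 'M[R]_2 -> Prop :=
  | heckeG_S : heckeG p (heckeS R p)
  | heckeG_T : heckeG p (heckeT R)
  | heckeG_1 : heckeG p 1%:M
  | heckeG_M M N : heckeG p M -> heckeG p N -> heckeG p (M *m N)
  | heckeG_V M : heckeG p M -> heckeG p (invmx M).

Definition projeq (R : realType) (M N : 'M[R]_2) : Prop := M = N \/ M = - N.

Definition hecke_conjugate (R : realType) (p : nat) (M N : 'M[R]_2) : Prop :=
  exists2 g, heckeG p g & projeq N (invmx g *m M *m g).

Definition hyperbolic (R : realType) (M : 'M[R]_2) : Prop := 2 < `|\tr M|.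

Definition primitive (R : realType) (p : nat) (M : 'M[R]_2) : Prop :=
  ~ exists N k, [/\ heckeG p N, (2 <= k)%N & projeq M (N ^+ k)].

(* The representatives of positive trace of the primitive hyperbolic elements of
   G_p; each such element has exactly one. *)
Definition prim_hyp (R : realType) (p : nat) : set 'M[R]_2 :=
  [set M | [/\ heckeG p M, 0 < \tr M, hyperbolic M & primitive p M]].

Definition mobius (R : realType) (M : 'M[R]_2) (x : R) : R :=
  (M 0 0 * x + M 0 1) / (M 1 0 * x + M 1 1).

(* A zero denominator means that [x] is sent to infinity. *)
Definition fixed_point (R : realType) (M : 'M[R]_2) (x : R) : Prop :=
  M 1 0 * x + M 1 1 != 0 /\ mobius M x = x.

Definition attracting (R : realType) (M : 'M[R]_2) (x : R) : Prop :=
  fixed_point M x /\ `|derive1 (mobius M) x| < 1.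

(* [hconj p x y]: [x] is a hyperbolic number and [y] is its Hecke-conjugate. *)
Definition hconj (R : realType) (p : nat) (x y : R) : Prop :=
  exists M, [/\ heckeG p M, hyperbolic M, fixed_point M x, fixed_point M y
              & y <> x].

Definition hconj_set (R : realType) (p : nat) (X : set R) : set R :=
  [set y | exists2 x, X x & hconj p x y].

Definition simple (R : realType) (p : nat) (x : R) : Prop :=
  exists2 y, hconj p x y & y < 0 < x.

(* [BQF A B C] is the form A x^2 + B x y + C y^2. *)
Record bqf (R : realType) := BQF { bqfA : R; bqfB : R; bqfC : R }.

Definition bqf_eval (R : realType) (Q : bqf R) (x y : R) : R :=
  bqfA Q * x ^+ 2 + bqfB Q * x * y + bqfC Q * y ^+ 2.

Definition Zlambda (R : realType) (p : nat) : set R :=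
  [set x | exists q : {poly int}, x = (map_poly intr q).[lambda R p]].

Definition lambda_bqf (R : realType) (p : nat) (Q : bqf R) : Prop :=
  [/\ Zlambda p (bqfA Q), Zlambda p (bqfB Q) & Zlambda p (bqfC Q)].

Definition bqf_act (R : realType) (Q : bqf R) (M : 'M[R]_2) : bqf R :=
  let: BQF A B C := Q in
  let a := M 0 0 in let b := M 0 1 in let c := M 1 0 in let d := M 1 1 in
  BQF (A * a ^+ 2 + B * a * c + C * c ^+ 2)
      (2 * A * a * b + B * (a * d + b * c) + 2 * C * c * d)
      (A * b ^+ 2 + B * b * d + C * d ^+ 2).

Lemma bqf_actE (R : realType) (Q : bqf R) (M : 'M[R]_2) (x y : R) :
  bqf_eval (bqf_act Q M) x y
  = bqf_eval Q (M 0 0 * x + M 0 1 * y) (M 1 0 * x + M 1 1 * y).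
Proof. by case: Q => A B C; rewrite /bqf_eval /=; ring. Qed.

Definition bqf_equiv (R : realType) (p : nat) (Q Q' : bqf R) : Prop :=
  exists2 M, heckeG p M & Q' = bqf_act Q M.

Definition bqf_class (R : realType) (p : nat) (A : set (bqf R)) : Prop :=
  exists2 Q, lambda_bqf p Q & A = [set Q' | lambda_bqf p Q' /\ bqf_equiv p Q Q'].

Definition bqf_of_mx (R : realType) (M : 'M[R]_2) : bqf R :=
  BQF (M 1 0) (M 1 1 - M 0 0) (- M 0 1).

Definition hyperbolic_bqf (R : realType) (p : nat) (Q : bqf R) : Prop :=
  exists2 M, prim_hyp p M & Q = bqf_of_mx M.

Definition hyperbolic_class (R : realType) (p : nat) (A : set (bqf R)) : Prop :=
  bqf_class p A /\ A `<=` hyperbolic_bqf p.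

(* [Malpha p x M]: [M] is M_x, the primitive hyperbolic element with attracting
   fixed point [x]. *)
Definition Malpha (R : realType) (p : nat) (x : R) (M : 'M[R]_2) : Prop :=
  prim_hyp p M /\ attracting M x.

(* [Qalpha p x Q]: [Q] is the form Q_x. *)
Definition Qalpha (R : realType) (p : nat) (x : R) (Q : bqf R) : Prop :=
  exists2 M, Malpha p x M & Q = bqf_of_mx M.

Definition Zset (R : realType) (p : nat) (A : set (bqf R)) : set R :=
  [set x | simple p x /\ exists2 Q, Qalpha p x Q & A Q].

Definition ISP (R : realType) (p : nat) (A : set (bqf R)) : set R :=
  Zset p A `|` mobius (heckeT R) @` Zset p A.

Definition Mset (R : realType) (p : nat) (A : set (bqf R)) : set 'M[R]_2 :=
  [set M | exists2 x, Zset p A x & Malpha p x M].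

(* The elements M of G_p, given by either representative, with Q_M in A. *)
Definition conj_class_of (R : realType) (p : nat) (A : set (bqf R)) :
    set 'M[R]_2 :=
  [set N | exists M, [/\ projeq N M, prim_hyp p M & A (bqf_of_mx M)]].

Definition Vgen (R : realType) (p j : nat) : 'M[R]_2 :=
  heckeU R p ^+ j.-1 *m heckeS R p.

(* A word [:: j_1; ...; j_n] in the conjugacy class generators and its value
   V_{j_1} ... V_{j_n}. *)
Definition Vword (p : nat) (js : seq nat) : Prop :=
  {in js, forall j, (1 <= j <= p - 1)%N}.

Definition Vprod (R : realType) (p : nat) (js : seq nat) : 'M[R]_2 :=
  \prod_(j <- js) Vgen R p j.

Definition tr_word (p : nat) (js : seq nat) : seq nat :=
  [seq (p - j)%N | j <- rev js].

Definition cyclic_perm (s t : seq nat) : Prop := exists k, s = rot k t.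

(* Main.v *)
(** With s_j = sin (j pi / p) / sin (pi / p), the generator V_j is the matrix
    [[s_j, s_(j+1)], [s_(j-1), s_j]]: it is entrywise at least the identity, and
    its transpose is V_(p-j).  The V_j generate a free monoid, and every element
    of the Hecke group is, up to sign, T^a w T^b with w a word in the V_j.
    Hence the group is discrete, and its elements with positive entries are
    words.  Since M^T = T^-1 M^-1 T, freeness also shows that two words are
    conjugate only if they are cyclic permutations of each other, which settles
    the last two conditions.

    Two elements with a common fixed point, one of them hyperbolic, commute: the
    hyperbolic one contracts their commutator, which is unipotent, to the
    identity, so that this commutator is trivial by discreteness.  A primitive
    hyperbolic element with attracting fixed point x > 0 and repelling fixed
    point y < 0 has positive entries, so it is a word; as commuting words are
    powers of a common one, it is determined by x.

    The transpose of this element has attracting fixed point - 1 / y = T y.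
    Let X and Y be the sets of attracting fixed points of the positive
    matrices of the class and of their transposes.  The set of poles is the
    union of X and T X, and that of their Hecke-conjugates is the union of Y
    and T Y.  As X and Y consist of positive numbers, Hecke-symmetry means
    that X = Y, that is, that the positive matrices of the class are stable
    under transposition. *)

Require Import Defs.
From mathcomp Require Import all_boot all_order all_algebra.
From mathcomp Require Import ring lra zify.
From mathcomp Require Import all_classical all_reals all_analysis.

Set Implicit Arguments.
Unset Strict Implicit.
Unset Printing Implicit Defensive.

Import Order.TTheory GRing.Theory Num.Theory.
Import numFieldNormedType.Exports.

Local Open Scope classical_set_scope.
Local Open Scope ring_scope.

Lemma image_set_inj_on (T U : Type) (f : T -> U) (D X Y : set T) :
  set_inj D f -> X `<=` D -> Y `<=` D -> f @` X = f @` Y -> X = Y.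
Proof.
move=> f_inj.
have subXY (X' Y' : set T) :
    X' `<=` D -> Y' `<=` D -> f @` X' = f @` Y' -> X' `<=` Y'.
  move=> XD YD XY x Xx; have : (f @` Y') (f x) by rewrite -XY; exists x.
  move=> [y Yy yx]; suff <- : y = x by [].
  by apply: f_inj; rewrite ?inE; [exact: YD|exact: XD|].
by move=> XD YD XY; apply/seteqP; split; apply: subXY.
Qed.

Section SquareMatrices.
Variables (R : comUnitRingType) (n : nat).
Implicit Types M g : 'M[R]_n.+1.

Lemma det1_unitr M : \det M = 1 -> M \is a GRing.unit.
Proof. by move=> M1; rewrite unitmxE M1 unitr1. Qed.

Lemma trmxX M k : (M ^+ k)^T = M^T ^+ k.
Proof.
elim: k => [|k ih]; first by rewrite !expr0 trmx1.
by rewrite exprS exprSr -mulmxE trmx_mul ih.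
Qed.

Lemma mxtrace_conj M g : g \is a GRing.unit -> \tr (g^-1 * M * g) = \tr M.
Proof. by move=> gu; rewrite mxtrace_mulC mulmxE mulVKr. Qed.

End SquareMatrices.

Section Matrices22.

Lemma ord2_ind (P : 'I_2 -> Prop) : P 0 -> P 1 -> forall i, P i.
Proof.
move=> P0 P1 [[|[|//]] lti].
  by rewrite (_ : Ordinal _ = 0) //; exact/val_inj.
by rewrite (_ : Ordinal _ = 1) //; exact/val_inj.
Qed.

Lemma sum_ord2 (V : nmodType) (F : 'I_2 -> V) : \sum_i F i = F 0 + F 1.
Proof.
by rewrite !big_ord_recl big_ord0 addr0; congr (F _ + F _); exact/val_inj.
Qed.

Lemma eq_mx22 (T : Type) (M N : 'M[T]_2) : M 0 0 = N 0 0 -> M 0 1 = N 0 1 ->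
  M 1 0 = N 1 0 -> M 1 1 = N 1 1 -> M = N.
Proof. by move=> *; apply/matrixP; do 2![apply: ord2_ind]. Qed.

Lemma mul_mx22E (R : pzSemiRingType) (M N : 'M[R]_2) i j :
  (M * N) i j = M i 0 * N 0 j + M i 1 * N 1 j.
Proof. by rewrite mxE sum_ord2. Qed.

Lemma one_mx22E (R : pzSemiRingType) :
  (((1 : 'M[R]_2) 0 0 = 1) * ((1 : 'M[R]_2) 0 1 = 0) *
   ((1 : 'M[R]_2) 1 0 = 0) * ((1 : 'M[R]_2) 1 1 = 1))%type.
Proof. by rewrite !mxE. Qed.

Lemma opp_mxE (V : zmodType) (m n : nat) (M : 'M[V]_(m, n)) i j :
  (- M) i j = - M i j.
Proof. by rewrite mxE. Qed.

Lemma tr_mx22E (V : nmodType) (M : 'M[V]_2) : \tr M = M 0 0 + M 1 1.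
Proof. exact: sum_ord2. Qed.

Lemma det_mx22E (R : comNzRingType) (M : 'M[R]_2) :
  \det M = M 0 0 * M 1 1 - M 0 1 * M 1 0.
Proof.
rewrite (expand_det_row _ 0) sum_ord2 /cofactor !det_mx11 !mxE /= expr0 expr1.
rewrite mulN1r mul1r mulrN.
by congr (_ * M _ _ - _ * M _ _); exact/val_inj.
Qed.

Lemma inv_mx22E (R : comUnitRingType) (M : 'M[R]_2) : \det M = 1 ->
  ((M^-1 0 0 = M 1 1) * (M^-1 0 1 = - M 0 1) *
   (M^-1 1 0 = - M 1 0) * (M^-1 1 1 = M 0 0))%type.
Proof.
move=> M1; have -> : M^-1 = \adj M.
  by rewrite -[\adj M](mulKr (det1_unitr M1)) -mulmxE mul_mx_adj M1 mulmx1.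
rewrite !mxE /cofactor !det_mx11 !mxE /= expr0 expr1 sqrrN expr1n.
rewrite !mul1r !mulN1r.
by do !split; (congr (M _ _) || congr (- M _ _)); exact/val_inj.
Qed.

Lemma mx2E (R : realType) (a b c d : R) :
  ((mx2 a b c d 0 0 = a) * (mx2 a b c d 0 1 = b) *
   (mx2 a b c d 1 0 = c) * (mx2 a b c d 1 1 = d))%type.
Proof. by rewrite !mxE. Qed.

End Matrices22.

Section ProjectiveEquality.
Variable R : realType.
Implicit Types M N K g : 'M[R]_2.

Lemma projeq_refl M : projeq M M. Proof. by left. Qed.

Lemma projeqN M : projeq (- M) M. Proof. by right. Qed.

Lemma projeq_trans M N K : projeq M N -> projeq N K -> projeq M K.
Proof. by case=> -> [] ->; rewrite ?opprK; [left|right|right|left]. Qed.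

Lemma projeq_sym M N : projeq M N -> projeq N M.
Proof. by case=> ->; [left|right; rewrite opprK]. Qed.

Lemma projeqM M M' N N' : projeq M N -> projeq M' N' ->
  projeq (M * M') (N * N').
Proof.
by case=> -> [] ->; rewrite ?mulrN ?mulNr ?opprK; [left|right|right|left].
Qed.

Lemma projeq_trmx M N : projeq M N -> projeq M^T N^T.
Proof. by case=> ->; [left|right; rewrite raddfN]. Qed.

Lemma projeq_tr_gt0 M N : 0 < \tr M -> 0 < \tr N -> projeq M N -> M = N.
Proof.
by move=> M0 N0 [//|MN]; rewrite MN raddfN oppr_gt0 (lt_gtF N0) in M0.
Qed.

Lemma projeq_conj M N g : projeq M N -> projeq (g^-1 * M * g) (g^-1 * N * g).
Proof.
by move=> MN; exact: projeqM (projeqM (projeq_refl _) MN) (projeq_refl _).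
Qed.

End ProjectiveEquality.

Section SineRatios.
Variables (R : realType) (p : nat).
Hypothesis p_gt1 : (1 < p)%N.

Let theta : R := pi / p%:R.

Definition sin_ratio (j : nat) : R := sin (j%:R * theta) / sin theta.

Let p_gt0 : 0 < p%:R :> R. Proof. by rewrite ltr0n ltnW. Qed.

Let theta_gt0 : 0 < theta. Proof. by rewrite divr_gt0 // pi_gt0. Qed.

Let mul_p_theta : p%:R * theta = pi.
Proof. by rewrite mulrC divfK // lt0r_neq0. Qed.

Let mul_nat_theta_le m : (m <= p)%N -> 0 <= m%:R * theta <= pi.
Proof.
move=> mp; rewrite -mul_p_theta ler_pM2r // ler_nat mp andbT.
by rewrite mulr_ge0 // ltW.
Qed.

Let sin_theta_gt0 : 0 < sin theta.
Proof.
apply: sin_gt0_pi; rewrite theta_gt0 -mul_p_theta -[ltLHS]mul1r ltr_pM2r //.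
by rewrite ltr1n.
Qed.

Lemma sin_ratio0 : sin_ratio 0 = 0.
Proof. by rewrite /sin_ratio mul0r sin0 mul0r. Qed.

Lemma sin_ratio1 : sin_ratio 1 = 1.
Proof. by rewrite /sin_ratio mul1r divff // lt0r_neq0. Qed.

Lemma sin_ratioSS j :
  sin_ratio j.+2 = lambda R p * sin_ratio j.+1 - sin_ratio j.
Proof.
have -> : sin_ratio j = sin (j.+1%:R * theta - theta) / sin theta.
  by rewrite /sin_ratio; congr (sin _ / _); rewrite -natr1; ring.
have -> : sin_ratio j.+2 = sin (j.+1%:R * theta + theta) / sin theta.
  by rewrite /sin_ratio; congr (sin _ / _); rewrite -(natr1 j.+1); ring.
by rewrite /sin_ratio /lambda -/theta sinB sinD; ring.
Qed.

Lemma sin_ratio_subn j : (j <= p)%N -> sin_ratio (p - j) = sin_ratio j.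
Proof.
move=> jp; rewrite /sin_ratio natrB // mulrBl mul_p_theta sinB sinpi cospi.
by congr (_ / _); ring.
Qed.

Lemma sin_ratio_p : sin_ratio p = 0.
Proof. by rewrite -[p in sin_ratio p]subn0 sin_ratio_subn ?sin_ratio0. Qed.

(* With a = (j + 1) theta / 2 and b = (j - 1) theta / 2, both in [0, pi / 2],
   sin (j theta) - sin theta = sin (a + b) - sin (a - b) = 2 cos a sin b. *)
Lemma sin_ratio_ge1 j : (1 <= j <= p - 1)%N -> 1 <= sin_ratio j.
Proof.
move=> /andP[j1 jp]; rewrite /sin_ratio ler_pdivlMr // mul1r -subr_ge0.
have jE : j.-1%:R = j%:R - 1 :> R by rewrite -subn1 natrB.
pose a := j.+1%:R * theta / 2; pose b := j.-1%:R * theta / 2.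
have -> : j%:R * theta = a + b by rewrite /a /b jE -natr1; lra.
have -> : theta = a - b by rewrite /a /b jE -natr1; lra.
have /andP[a0 api] : 0 <= j.+1%:R * theta <= pi by apply: mul_nat_theta_le; lia.
have /andP[b0 bpi] : 0 <= j.-1%:R * theta <= pi by apply: mul_nat_theta_le; lia.
have pi0 := pi_gt0 R.
have cos_a : 0 <= cos a.
  by apply: cos_ge0_pihalf; rewrite /a; apply/andP; split; lra.
have sin_b : 0 <= sin b.
  by apply: sin_ge0_pi; rewrite /b; apply/andP; split; lra.
by rewrite sinD sinB; have := mulr_ge0 cos_a sin_b; lra.
Qed.

Lemma sin_ratio_ge0 j : (j <= p)%N -> 0 <= sin_ratio j.
Proof.
move=> jp; have /andP[j0 jpi] := mul_nat_theta_le jp.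
by rewrite divr_ge0 ?(ltW sin_theta_gt0) // sin_ge0_pi // j0.
Qed.

End SineRatios.

Section HeckeGroup.
Variables (R : realType) (p : nat).
Implicit Types M N K g : 'M[R]_2.

Local Notation S := (heckeS R p).
Local Notation T := (heckeT R).
Local Notation U := (heckeU R p).

Lemma heckeGM M N : heckeG p M -> heckeG p N -> heckeG p (M * N).
Proof. exact: heckeG_M. Qed.

Lemma heckeGV M : heckeG p M -> heckeG p M^-1.
Proof. exact: heckeG_V. Qed.

Lemma heckeGX M k : heckeG p M -> heckeG p (M ^+ k).
Proof.
move=> GM; elim: k => [|k ih]; first by rewrite expr0; exact: heckeG_1.
by rewrite exprS; exact: heckeGM.
Qed.

Lemma heckeG_det M : heckeG p M -> \det M = 1.
Proof.
elim=> {M} [|||M N _ M1 _ N1|M _ M1].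
- by rewrite det_mx22E !mx2E; ring.
- by rewrite det_mx22E !mx2E; ring.
- exact: det1.
- by rewrite det_mulmx M1 N1 mulr1.
- by rewrite det_inv M1 invr1.
Qed.

Lemma heckeG_unit M : heckeG p M -> M \is a GRing.unit.
Proof. by move=> /heckeG_det/det1_unitr. Qed.

Lemma heckeG_U : heckeG p U.
Proof. exact: heckeGM (heckeG_S R p) (heckeG_T R p). Qed.

Lemma heckeT_unit : T \is a GRing.unit.
Proof. by apply: det1_unitr; rewrite det_mx22E !mx2E; ring. Qed.

Lemma heckeU_unit : U \is a GRing.unit.
Proof. exact: heckeG_unit heckeG_U. Qed.

Lemma heckeT_sq : T * T = -1.
Proof. by apply: eq_mx22; rewrite mul_mx22E opp_mxE !mx2E one_mx22E; ring. Qed.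

Lemma heckeTV : T^-1 = - T.
Proof.
apply: (mulrI heckeT_unit).
by rewrite divrr ?heckeT_unit // mulrN heckeT_sq opprK.
Qed.

Lemma heckeT_mulE N : ((T * N) 0 0 = - N 1 0) * ((T * N) 0 1 = - N 1 1) *
  ((T * N) 1 0 = N 0 0) * ((T * N) 1 1 = N 0 1).
Proof. by rewrite !mul_mx22E !mx2E; do !split; ring. Qed.

Lemma mul_heckeTE N : ((N * T) 0 0 = N 0 1) * ((N * T) 0 1 = - N 0 0) *
  ((N * T) 1 0 = N 1 1) * ((N * T) 1 1 = - N 1 0).
Proof. by rewrite !mul_mx22E !mx2E; do !split; ring. Qed.

Lemma heckeT_conjC M : T * M * T^-1 = T^-1 * M * T.
Proof. by rewrite heckeTV mulrN !mulNr. Qed.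

Lemma heckeSE : S = - (U * T).
Proof. by rewrite /heckeU mulmxE -mulrA heckeT_sq mulrN mulr1 opprK. Qed.

Lemma trmx_heckeT M : \det M = 1 -> M^T = T^-1 * M^-1 * T.
Proof.
move=> M1; rewrite heckeTV; apply: eq_mx22;
  by rewrite !mul_mx22E !opp_mxE !inv_mx22E // !mx2E mxE; ring.
Qed.

Lemma heckeG_trmx M : heckeG p M -> heckeG p M^T.
Proof.
move=> GM; rewrite trmx_heckeT ?(heckeG_det GM) //; have GT := heckeG_T R p.
exact: heckeGM (heckeGM (heckeGV GT) (heckeGV GM)) GT.
Qed.

Lemma hecke_conjugateE M N : hecke_conjugate p M N =
  (exists2 g, heckeG p g & projeq N (g^-1 * M * g)).
Proof. by []. Qed.

Lemma hecke_conjugate_sym M N : hecke_conjugate p M N -> hecke_conjugate p N M.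
Proof.
rewrite !hecke_conjugateE => -[g Gg NM]; have gu := heckeG_unit Gg.
exists g^-1; first exact: heckeGV.
have := projeq_conj g^-1 (projeq_sym NM).
by rewrite !mulrA invrK divrr // mul1r mulrK.
Qed.

Lemma hecke_conjugate_trans M N K :
  hecke_conjugate p M N -> hecke_conjugate p N K -> hecke_conjugate p M K.
Proof.
rewrite !hecke_conjugateE => -[g Gg NM] [h Gh KN].
exists (g * h); first exact: heckeGM.
apply: projeq_trans KN _; rewrite invrM ?(heckeG_unit Gg) ?(heckeG_unit Gh) //.
by have := projeq_conj h NM; rewrite !mulrA.
Qed.

Lemma hecke_conjugate_trmx M N :
  hecke_conjugate p M N -> hecke_conjugate p M^T N^T.
Proof.
rewrite !hecke_conjugateE => -[g Gg NM].
exists (g^T)^-1; first exact/heckeGV/heckeG_trmx.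
have := projeq_trmx NM.
by rewrite -!mulmxE !trmx_mul trmx_inv invrK !mulmxE mulrA.
Qed.

Lemma hecke_conjugateP M N : 0 < \tr M -> 0 < \tr N ->
  hecke_conjugate p M N <-> exists2 g, heckeG p g & N = g^-1 * M * g.
Proof.
move=> M0 N0; rewrite hecke_conjugateE.
split=> -[g Gg MN]; exists g => //; last by left.
by apply: projeq_tr_gt0 MN; rewrite // mxtrace_conj ?(heckeG_unit Gg).
Qed.

Lemma prim_hyp_trmx M : prim_hyp p M -> prim_hyp p M^T.
Proof.
move=> [GM tM hM pM]; split; rewrite /hyperbolic ?mxtrace_tr //.
  exact: heckeG_trmx.
move=> [N [k [GN k2 MN]]]; apply: pM; exists N^T, k; split=> //.
  exact: heckeG_trmx.
by have := projeq_trmx MN; rewrite trmxK trmxX.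
Qed.

Lemma primitive_exp_eq1 N k : heckeG p N ->
  hyperbolic (N ^+ k) -> primitive p (N ^+ k) -> k = 1%N.
Proof.
case: k => [|[//|k]] GN hN pN.
  by move: hN; rewrite expr0 /hyperbolic mxtrace1 normr_nat ltxx.
by case: pN; exists N, k.+2; split=> //; left.
Qed.

End HeckeGroup.

Section Words.
Variables (R : realType) (p : nat).
Implicit Types u v w : seq nat.

Local Notation T := (heckeT R).
Local Notation U := (heckeU R p).
Local Notation V := (Vgen R p).
Local Notation Vprod := (Vprod R p).

Lemma Vgen_heckeU j : (0 < j)%N -> V j = - (U ^+ j * T).
Proof.
by case: j => // j _; rewrite /Vgen mulmxE heckeSE mulrN mulrA -exprSr.
Qed.

Lemma heckeUX_Vgen i j : (0 < j)%N -> U ^+ i * V j = V (i + j).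
Proof.
move=> j0; rewrite !Vgen_heckeU ?addn_gt0 ?j0 ?orbT //.
by rewrite mulrN mulrA -exprD.
Qed.

Lemma Vword_cons j w :
  Vword p (j :: w) <-> (1 <= j <= p - 1)%N /\ Vword p w.
Proof.
split=> [jw|[jp wp] i]; last by rewrite inE => /predU1P[->|/wp].
by split=> [|i iw]; apply: jw; rewrite inE ?eqxx ?iw ?orbT.
Qed.

Lemma Vword_cat u v : Vword p (u ++ v) <-> Vword p u /\ Vword p v.
Proof.
split=> [uv|[up vp] i]; last by rewrite mem_cat => /orP[/up|/vp].
by split=> i iw; apply: uv; rewrite mem_cat iw ?orbT.
Qed.

Lemma Vword_tr_word w : Vword p w -> Vword p (tr_word p w).
Proof. by move=> wp i /mapP[j]; rewrite mem_rev => /wp jp ->; lia. Qed.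

Lemma tr_wordK w : Vword p w -> tr_word p (tr_word p w) = w.
Proof.
move=> wp; rewrite /tr_word -map_rev revK -map_comp -[RHS]map_id.
by apply/eq_in_map => j /wp jp /=; lia.
Qed.

Lemma cyclic_perm_tr_word u v :
  cyclic_perm u v -> cyclic_perm (tr_word p u) (tr_word p v).
Proof. by move=> [k ->]; rewrite /tr_word rev_rot /rotr map_rot; eexists. Qed.

Lemma Vprod_nil : Vprod [::] = 1. Proof. exact: big_nil. Qed.

Lemma Vprod_cons j w : Vprod (j :: w) = V j * Vprod w.
Proof. exact: big_cons. Qed.

Lemma Vprod_cat u v : Vprod (u ++ v) = Vprod u * Vprod v.
Proof. exact: big_cat. Qed.

Lemma Vprod_flatten_nseq k w : Vprod (flatten (nseq k w)) = Vprod w ^+ k.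
Proof. by rewrite /Vprod big_flatten big_nseq iter_mulr_1. Qed.

Lemma heckeG_Vprod w : heckeG p (Vprod w).
Proof.
rewrite /Vprod; elim/big_ind: _ => [|M N|j _].
- exact: heckeG_1.
- exact: heckeGM.
exact: heckeGM (heckeGX _ (heckeG_U R p)) (heckeG_S R p).
Qed.

End Words.

Section NormalForm.
Variables (R : realType) (p : nat).
Hypothesis p_gt1 : (1 < p)%N.
Implicit Types (M N : 'M[R]_2) (w : seq nat).

Local Notation s := (sin_ratio R p).
Local Notation T := (heckeT R).
Local Notation U := (heckeU R p).
Local Notation V := (Vgen R p).
Local Notation Vprod := (Vprod R p).

Lemma heckeUX j : U ^+ j.+1 = mx2 (s j.+2) (- s j.+1) (s j.+1) (- s j).
Proof.
have UE : U = mx2 (lambda R p) (-1) 1 0.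
  by apply: eq_mx22; rewrite /heckeU mulmxE mul_mx22E !mx2E; ring.
elim: j => [|j ih]; last first.
  rewrite exprS ih UE (sin_ratioSS _ _ j.+1) (sin_ratioSS _ _ j).
  by apply: eq_mx22; rewrite mul_mx22E !mx2E; ring.
by rewrite expr1 UE sin_ratioSS sin_ratio1 // sin_ratio0 mulr1 subr0 oppr0.
Qed.

Lemma heckeUX_p : U ^+ p = -1.
Proof.
have pE : p.-1.+1 = p by lia.
have s1 : s p.-1 = 1 by rewrite -subn1 sin_ratio_subn ?sin_ratio1 //; lia.
have sS : s p.+1 = -1.
  by have := sin_ratioSS R p p.-1; rewrite pE sin_ratio_p // s1; lra.
have := heckeUX p.-1; rewrite pE sS s1 sin_ratio_p // => ->.
by apply: eq_mx22; rewrite opp_mxE mx2E one_mx22E; ring.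
Qed.

Lemma heckeUV : U^-1 = - U ^+ p.-1.
Proof.
have Uu := heckeU_unit R p.
apply: (mulrI Uu).
by rewrite divrr // mulrN -exprS prednK ?(ltnW p_gt1) // heckeUX_p opprK.
Qed.

Lemma Vgen_p : V p = T.
Proof. by rewrite Vgen_heckeU ?(ltnW p_gt1) // heckeUX_p mulN1r opprK. Qed.

Lemma Vgen_mx2 j : (0 < j)%N -> V j = mx2 (s j) (s j.+1) (s j.-1) (s j).
Proof.
case: j => // j _; rewrite Vgen_heckeU // heckeUX.
by apply: eq_mx22; rewrite opp_mxE mul_mx22E !mx2E; ring.
Qed.

Lemma Vgen_trmx j : (1 <= j <= p - 1)%N -> (V j)^T = V (p - j).
Proof.
move=> jp; rewrite !Vgen_mx2; try lia.
have -> : (p - j).+1 = (p - j.-1)%N by lia.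
have -> : (p - j).-1 = (p - j.+1)%N by lia.
rewrite !sin_ratio_subn; try lia.
by apply: eq_mx22; rewrite mxE !mx2E.
Qed.

Lemma Vprod_trmx w : Vword p w -> (Vprod w)^T = Vprod (tr_word p w).
Proof.
elim: w => [|j w ih]; first by rewrite Vprod_nil trmx1.
move=> /Vword_cons[jp wp].
rewrite Vprod_cons -mulmxE trmx_mul ih // Vgen_trmx // mulmxE.
rewrite /tr_word rev_cons map_rcons -cats1 Vprod_cat.
by rewrite Vprod_cons Vprod_nil mulr1.
Qed.

Definition normal_form M := exists (a b : bool) w,
  Vword p w /\ projeq M (T ^+ a * Vprod w * T ^+ b).

Lemma normal_form_projeq M N : projeq M N -> normal_form N -> normal_form M.
Proof.
move=> MN [a [b [w [wp Nw]]]]; exists a, b, w; split=> //.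
exact: projeq_trans MN Nw.
Qed.

Lemma normal_form1 : normal_form 1.
Proof.
by exists false, false, [::]; rewrite Vprod_nil expr0 !mulr1; split=> //; left.
Qed.

Lemma normal_form_mulT M : normal_form M -> normal_form (T * M).
Proof.
move=> [a [b [w [wp Mw]]]]; exists (~~ a), b, w; split=> //.
apply: projeq_trans (projeqM (projeq_refl T) Mw) _.
case: a {Mw}; rewrite /= ?expr1 ?expr0 ?mulrA ?mulr1; last by left.
by rewrite heckeT_sq !mulNr; right.
Qed.

Lemma normal_form_mulU M : normal_form M -> normal_form (U * M).
Proof.
move=> [a [b [w [wp Mw]]]].
apply: normal_form_projeq (projeqM (projeq_refl U) Mw) _ => {Mw}.
have V1 : V 1 = - (U * T) by rewrite Vgen_heckeU.
have word1 v : Vword p v -> Vword p (1%N :: v).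
  by move=> vp; apply/Vword_cons; split=> //; lia.
case: a => /=.
  exists false, b, (1%N :: w); split; first exact: word1.
  right; rewrite expr1 expr0 mul1r Vprod_cons V1 !mulNr !mulrA.
  by rewrite opprK.
rewrite expr0 mul1r; case: w wp => [wp|j w /Vword_cons[jp wp]].
  exists false, (~~ b), [:: 1%N]; split; first exact: word1.
  rewrite expr0 mul1r Vprod_nil mul1r Vprod_cons Vprod_nil mulr1 V1.
  case: b; rewrite /= expr1 expr0 mulr1; first by right; rewrite opprK.
  by left; rewrite mulNr -mulrA heckeT_sq mulrN1 opprK.
have UVj : U * V j = V j.+1 by apply: (heckeUX_Vgen R p 1); case/andP: jp.
rewrite Vprod_cons -[V j * _ * _]mulrA mulrA UVj mulrA.
have [->|jp1] := eqVneq j.+1 p.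
  by exists true, b, w; rewrite Vgen_p expr1; split=> //; left.
exists false, b, (j.+1 :: w).
rewrite expr0 mul1r Vprod_cons; split; last by left.
by apply/Vword_cons; split=> //; lia.
Qed.

Lemma heckeG_TU_ind (P : 'M[R]_2 -> Prop) :
    (forall M N, projeq M N -> P N -> P M) -> P 1 ->
    (forall M, P M -> P (T * M)) -> (forall M, P M -> P (U * M)) ->
  forall M, heckeG p M -> P M.
Proof.
move=> Pproj P1 PT PU M GM.
have PUX k N : P N -> P (U ^+ k * N).
  elim: k N => [|k ih] N PN; first by rewrite expr0 mul1r.
  by rewrite exprSr -mulrA; exact/ih/PU.
suff [H _] : (forall N, P N -> P (M * N)) /\ (forall N, P N -> P (M^-1 * N)).
  by rewrite -[M]mulr1; exact: H.
elim: GM => {M} [|||M M' GM [ihM ihMV] GM' [ihM' ihMV']|M _ [ihM ihMV]].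
- split=> N PN.
    apply: (Pproj _ (U * (T * N))); last exact/PU/PT.
    by rewrite heckeSE mulNr mulrA; right.
  apply: (Pproj _ (T * (U ^+ p.-1 * N))); last exact/PT/PUX.
  rewrite heckeSE invrN invrM ?(heckeU_unit R p) ?heckeT_unit //.
  by rewrite heckeUV heckeTV !(mulNr, mulrN) !opprK mulrA; right.
- split=> [|N PN]; first exact: PT.
  by rewrite heckeTV mulNr; apply: Pproj (projeqN _) _; exact: PT.
- by split=> N; rewrite ?invr1 mul1r.
- split=> N PN; first by rewrite -mulrA; exact/ihM/ihM'.
  rewrite [_^-1]invrM ?(heckeG_unit GM) ?(heckeG_unit GM') // -mulrA.
  exact/ihMV'/ihMV.
- by split=> N PN; [exact: ihMV|rewrite [_^-1]invrK; exact: ihM].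
Qed.

Lemma heckeG_normal_form M : heckeG p M -> normal_form M.
Proof.
move: M; apply: heckeG_TU_ind.
- exact: normal_form_projeq.
- exact: normal_form1.
- exact: normal_form_mulT.
- exact: normal_form_mulU.
Qed.

Lemma heckeG_cases M : heckeG p M -> exists2 w, Vword p w &
  [\/ projeq M (Vprod w), projeq M (T * Vprod w), projeq M (Vprod w * T)
   | projeq M (T * Vprod w * T)].
Proof.
move=> /heckeG_normal_form[a [b [w [wp Mw]]]]; exists w => //.
by case: a b Mw => [] []; rewrite ?expr1 ?expr0 ?mul1r ?mulr1 => Mw;
  [apply: Or44|apply: Or42|apply: Or43|apply: Or41].
Qed.

End NormalForm.

Section EntrywiseBounds.
Variable R : numDomainType.

Definition ge1mx n (M : 'M[R]_n) := forall i j, (1%:M : 'M[R]_n) i j <= M i j.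

Definition posmx n (M : 'M[R]_n) := forall i j, 0 < M i j.

Lemma ge1mxM n (M N : 'M[R]_n) : ge1mx M -> ge1mx N -> ge1mx (M *m N).
Proof.
have scalar_ge0 i j : 0 <= (1%:M : 'M[R]_n) i j by rewrite mxE ler0n.
move=> M1 N1 i j; rewrite -[1%:M]mulmx1 !mxE.
by apply: ler_sum => k _; exact: ler_pM.
Qed.

Lemma posmx_trmx n (M : 'M[R]_n) : posmx M -> posmx M^T.
Proof. by move=> M0 i j; rewrite mxE. Qed.

Lemma ge1mx22P (M : 'M[R]_2) :
  ge1mx M <-> [/\ 1 <= M 0 0, 0 <= M 0 1, 0 <= M 1 0 & 1 <= M 1 1].
Proof.
split=> [M1|[? ? ? ?]]; last by do 2![apply: ord2_ind]; rewrite mxE.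
have := (M1 0 0, M1 0 1, M1 1 0, M1 1 1).
by rewrite !mxE => -[[[? ?] ?] ?].
Qed.

Lemma posmx22P (M : 'M[R]_2) :
  posmx M <-> [/\ 0 < M 0 0, 0 < M 0 1, 0 < M 1 0 & 0 < M 1 1].
Proof.
by split=> [M0|[? ? ? ?]]; [split; exact: M0|do 2![apply: ord2_ind]].
Qed.

End EntrywiseBounds.

Lemma ge1mx_hyperbolic_posmx (R : realType) (M : 'M[R]_2) :
  \det M = 1 -> ge1mx M -> hyperbolic M -> posmx M.
Proof.
rewrite /hyperbolic det_mx22E tr_mx22E => M1 /ge1mx22P[a1 b0 c0 d1].
rewrite gtr0_norm => [tM|]; last lra.
have bc0 : 0 < M 0 1 * M 1 0 by nra.
have [b_neq0 c_neq0] : M 0 1 != 0 /\ M 1 0 != 0.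
  by split; apply/eqP => e0; move: bc0; rewrite e0 ?mul0r ?mulr0 ltxx.
by apply/posmx22P; split; rewrite ?lt0r ?b_neq0 ?c_neq0 //; lra.
Qed.

Section PositiveWords.
Variables (R : realType) (p : nat).
Hypothesis p_gt1 : (1 < p)%N.
Implicit Types (M N : 'M[R]_2) (w : seq nat).

Local Notation V := (Vgen R p).
Local Notation Vprod := (Vprod R p).

Lemma ge1mx_Vgen j : (1 <= j <= p - 1)%N -> ge1mx (V j).
Proof.
move=> jp; apply/ge1mx22P; rewrite Vgen_mx2 ?mx2E //; last lia.
by split; do ?[apply: sin_ratio_ge1 | apply: sin_ratio_ge0]; lia.
Qed.

Lemma ge1mx_Vprod w : Vword p w -> ge1mx (Vprod w).
Proof.
elim: w => [|j w ih]; first by rewrite Vprod_nil => _ i j; exact: lexx.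
move=> /Vword_cons[jp wp]; rewrite Vprod_cons.
exact: ge1mxM (ge1mx_Vgen jp) (ih wp).
Qed.

Lemma tr_Vprod_gt0 w : Vword p w -> 0 < \tr (Vprod w).
Proof. by move=> /ge1mx_Vprod/ge1mx22P[a1 _ _ d1]; rewrite tr_mx22E; lra. Qed.

(* Cancelling [U ^+ i] would exhibit the nonnegative matrix
   [V (j - i) * N] as [- (T * M)], whose bottom row is [- M 0 _]. *)
Lemma Vgen_mul_neq i j M N : (0 < i < j)%N -> (j <= p - 1)%N ->
  ge1mx M -> ge1mx N -> V i * M <> V j * N.
Proof.
move=> /andP[i0 ij] jp M1 N1; rewrite Vgen_heckeU //.
have -> : j = (i + (j - i))%N by rewrite subnKC // ltnW.
rewrite -heckeUX_Vgen ?subn_gt0 // -mulrN -[LHS]mulrA -[RHS]mulrA.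
move=> /(mulrI (unitrX i (heckeU_unit R p))) TMN.
have jip : (1 <= j - i <= p - 1)%N by lia.
have /ge1mx22P[_ _ c0 _] := ge1mxM (ge1mx_Vgen jip) N1.
have /ge1mx22P[a1 _ _ _] := M1.
by move: c0; rewrite mulmxE -TMN mulNr opp_mxE mul_mx22E !mx2E; lra.
Qed.

Lemma heckeG_posmx_Vprod M :
  heckeG p M -> posmx M -> exists2 w, Vword p w & M = Vprod w.
Proof.
move=> /(heckeG_cases p_gt1)[w wp Mw] /posmx22P[a0 b0 c0 d0]; exists w => //.
have /ge1mx22P[a1' b0' c0' d1'] := ge1mx_Vprod wp.
by case: Mw => [] [] // ME; exfalso; move: a0 b0 c0 d0;
  rewrite ME ?opp_mxE ?mul_heckeTE ?heckeT_mulE; lra.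
Qed.

End PositiveWords.

Section FreeWords.
Variables (R : realType) (p : nat).
Hypothesis p_ge3 : (3 <= p)%N.
Implicit Types (M : 'M[R]_2) (u v w : seq nat).

Let p_gt1 : (1 < p)%N := ltnW p_ge3.

Local Notation V := (Vgen R p).
Local Notation Vprod := (Vprod R p).

Lemma Vgen_offdiag_ge1 j : (1 <= j <= p - 1)%N -> 1 <= V j 0 1 + V j 1 0.
Proof.
move=> jp; rewrite Vgen_mx2 ?mx2E //; last lia.
have [-> | jp1] := eqVneq j (p - 1)%N.
  by rewrite ler_wpDl ?sin_ratio_ge0 ?sin_ratio_ge1 //; lia.
by rewrite ler_wpDr ?sin_ratio_ge0 ?sin_ratio_ge1 //; lia.
Qed.

Lemma Vprod_cons_offdiag_ge1 j w : Vword p (j :: w) ->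
  1 <= Vprod (j :: w) 0 1 + Vprod (j :: w) 1 0.
Proof.
move=> /Vword_cons[jp wp]; rewrite Vprod_cons !(mul_mx22E (V j)).
have /ge1mx22P[a1 b0 c0 d1] := ge1mx_Vprod R p_gt1 wp.
have /ge1mx22P[a1' b0' c0' d1'] := ge1mx_Vgen R p_gt1 jp.
by have := Vgen_offdiag_ge1 jp; nra.
Qed.

Lemma Vprod_offdiag_lt1 w :
  Vword p w -> Vprod w 0 1 + Vprod w 1 0 < 1 -> w = [::].
Proof. by case: w => // j w /Vprod_cons_offdiag_ge1/le_gtF ->. Qed.

Lemma Vprod_inj u v : Vword p u -> Vword p v -> Vprod u = Vprod v -> u = v.
Proof.
have eq1 w : Vword p w -> Vprod w = 1 -> w = [::].
  move=> wp w1; apply: Vprod_offdiag_lt1 => //.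
  by rewrite w1 !one_mx22E addr0 ltr01.
elim: u v => [|i u ih] [|j v] //.
- by rewrite Vprod_nil => _ vp /esym/(eq1 _ vp).
- by rewrite Vprod_nil => up _ /(eq1 _ up).
move=> /Vword_cons[ip up] /Vword_cons[jp vp]; rewrite !Vprod_cons => uv.
have [u_ge1 v_ge1] := (ge1mx_Vprod R p_gt1 up, ge1mx_Vprod R p_gt1 vp).
have [ij|ji|ij] := ltngtP i j.
- by exfalso; move: uv; apply: Vgen_mul_neq => //; lia.
- by exfalso; move/esym: uv; apply: Vgen_mul_neq => //; lia.
have Vj_unit : V j \is a GRing.unit.
  by have := heckeG_unit (heckeG_Vprod R p [:: j]); rewrite /Vprod big_seq1.
by rewrite -ij in Vj_unit uv *; congr cons; apply: ih; last exact: mulrI uv.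
Qed.

Lemma heckeG_discrete M :
  heckeG p M -> `|M 0 1| + `|M 1 0| < 1 -> projeq M 1.
Proof.
move=> /(heckeG_cases p_gt1)[w wp Mw].
have /ge1mx22P[a1 b0 c0 d1] := ge1mx_Vprod R p_gt1 wp.
have offdiagN N : projeq M N -> `|M 0 1| + `|M 1 0| = `|N 0 1| + `|N 1 0|.
  by case=> ->; rewrite ?opp_mxE ?normrN.
have [a_ge0 d_ge0] : 0 <= Vprod w 0 0 /\ 0 <= Vprod w 1 1 by split; lra.
case: Mw => MN; rewrite (offdiagN _ MN) ?mul_heckeTE ?heckeT_mulE ?normrN;
  rewrite !ger0_norm //.
- by move=> /(Vprod_offdiag_lt1 wp) w0; move: MN; rewrite w0 Vprod_nil.
- lra.
- lra.
rewrite addrC => /(Vprod_offdiag_lt1 wp) w0; move: MN.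
rewrite w0 Vprod_nil mulr1 heckeT_sq => /projeq_trans; apply.
exact: projeqN.
Qed.

End FreeWords.

Section WordCombinatorics.
Variable T : eqType.
Implicit Types t u v w : seq T.

Lemma cat_comm_power u v : u ++ v = v ++ u -> exists t i j,
  u = flatten (nseq i t) /\ v = flatten (nseq j t).
Proof.
have [n] := ubnP (size u + size v); elim: n u v => // n ih u v uvn uv.
wlog suv : u v uvn uv / (size u <= size v)%N.
  move=> H; have [|/ltnW] := leqP (size u) (size v); first exact: H.
  rewrite addnC in uvn => /(H _ _ uvn (esym uv))[t [i [j []]]].
  by exists t, j, i.
case: u uvn uv suv => [_ _ _|x u uvn uv suv].
  by exists v, 0%N, 1%N; rewrite /= cats0.
have vE : v = (x :: u) ++ drop (size (x :: u)) v.
  have /(congr1 (take (size (x :: u)))) := uv.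
  by rewrite take_size_cat // takel_cat // => e; rewrite {1}e cat_take_drop.
move: uv; rewrite vE -catA => /eqP; rewrite eqseq_cat // eqxx => /eqP uv'.
have [|t [i [j [ui vj]]]] := ih _ _ _ uv'; last first.
  by exists t, i, (i + j)%N; rewrite nseqD flatten_cat -ui -vj.
by move: uvn; rewrite {1}vE !size_cat /=; lia.
Qed.

Lemma cat_conj_rot u v w : u ++ w = w ++ v -> exists k, u = rot k v.
Proof.
elim: w u => [u|x w ih [|y u]].
- by rewrite cats0 => ->; exists 0%N; rewrite rot0.
- move=> /(congr1 size) /=; rewrite size_cat => size_v.
  by exists 0%N; rewrite rot0; apply/esym/nilP; rewrite /nilp; lia.
move=> [-> uw]; have [|k ukv] := ih (rcons u x); first by rewrite cat_rcons.
by rewrite -[x :: u]rotr1_rcons ukv /rotr rot_rot_add; eexists.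
Qed.

End WordCombinatorics.

Section ConjugateWords.
Variables (R : realType) (p : nat).
Hypothesis p_ge3 : (3 <= p)%N.
Implicit Types (g : 'M[R]_2) (u v w : seq nat).

Let p_gt1 : (1 < p)%N := ltnW p_ge3.

Local Notation T := (heckeT R).
Local Notation Vprod := (Vprod R p).

Let Vprod_unit w : Vprod w \is a GRing.unit.
Proof. exact: heckeG_unit (heckeG_Vprod R p w). Qed.

Lemma Vprod_tr_word w :
  Vword p w -> Vprod (tr_word p w) = T^-1 * (Vprod w)^-1 * T.
Proof.
move=> wp; rewrite -Vprod_trmx // trmx_heckeT //.
exact: heckeG_det (heckeG_Vprod R p w).
Qed.

Lemma Vprod_cat_inj u v u' v' :
    Vword p u -> Vword p v -> Vword p u' -> Vword p v' ->
  Vprod u * Vprod v = Vprod u' * Vprod v' -> u ++ v = u' ++ v'.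
Proof.
move=> up vp up' vp'; rewrite -!Vprod_cat.
by apply: (@Vprod_inj R p p_ge3); apply/Vword_cat.
Qed.

(* Write [g] as [T^a w T^b] up to sign.  Conjugation by [T] turns words into
   inverses of their transposes, so that [a <> b] would make [w] equal to a
   longer word. *)
Lemma Vprod_intertwine_cyclic u v g : Vword p u -> Vword p v -> u != [::] ->
  heckeG p g -> Vprod u * g = g * Vprod v -> cyclic_perm u v.
Proof.
move=> up vp u_neq0 /(heckeG_cases p_gt1)[w wp gw] ugv.
have [up' vp'] := (Vword_tr_word up, Vword_tr_word vp).
have Tu := heckeT_unit R.
have cat_neq (a b : seq nat) : size a = size u -> w <> a ++ w ++ b.
  have u_gt0 : (0 < size u)%N by case: (u) u_neq0.
  by move=> au /(congr1 size); rewrite !size_cat; lia.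
have sgn N : projeq g N -> Vprod u * N = N * Vprod v.
  by case=> gN; move: ugv; rewrite gN // mulrN mulNr => /oppr_inj.
case: gw => /sgn uX_Xv.
- have uw : u ++ w = w ++ v by exact: Vprod_cat_inj uX_Xv.
  exact: cat_conj_rot uw.
- exfalso; apply: (@cat_neq (tr_word p u) v).
    by rewrite size_map size_rev.
  apply: (@Vprod_inj R p p_ge3) => //.
    by do 2![apply/Vword_cat; split=> //].
  rewrite !Vprod_cat Vprod_tr_word //.
  by rewrite -!mulrA [T * _]mulrA -uX_Xv !mulKr.
- exfalso; apply: (@cat_neq u (tr_word p v)) => //.
  apply: (@Vprod_inj R p p_ge3) => //.
    by do 2![apply/Vword_cat; split=> //].
  rewrite !Vprod_cat Vprod_tr_word //.
  by rewrite -heckeT_conjC !mulrA in uX_Xv *; rewrite uX_Xv !mulrK.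
have uw : tr_word p u ++ w = w ++ tr_word p v.
  apply: Vprod_cat_inj => //; rewrite !Vprod_tr_word //.
  rewrite -[T^-1 / Vprod v * T]heckeT_conjC.
  apply: (mulrI Tu); apply: (mulIr Tu); rewrite !mulrA divrr // mul1r divrK //.
  apply: (mulrI (Vprod_unit u)); apply: (mulIr (Vprod_unit v)).
  by rewrite !mulrA in uX_Xv *; rewrite divrr // mul1r divrK.
rewrite -(tr_wordK up) -(tr_wordK vp); apply: cyclic_perm_tr_word.
exact: cat_conj_rot uw.
Qed.

Lemma Vprod_conjP u v : Vword p u -> Vword p v ->
  hecke_conjugate p (Vprod u) (Vprod v) <-> cyclic_perm u v.
Proof.
move=> up vp; rewrite hecke_conjugateP ?tr_Vprod_gt0 //.
split=> [[g Gg vE]|[k ->]].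
  have uv : Vprod u * g = g * Vprod v.
    by rewrite vE -mulrA mulVKr // (heckeG_unit Gg).
  have [u0|u_neq0] := eqVneq u [::]; last exact: Vprod_intertwine_cyclic Gg uv.
  exists 0%N; rewrite rot0 u0; apply: (@Vprod_inj R p p_ge3) => //.
  by rewrite vE u0 Vprod_nil mulr1 mulVr ?(heckeG_unit Gg).
exists (Vprod (drop k v)); first exact: heckeG_Vprod.
by rewrite -[in LHS](cat_take_drop k v) /rot !Vprod_cat mulKr ?Vprod_unit.
Qed.

End ConjugateWords.

Section FixedPoints.
Variable R : realType.
Implicit Types (M N : 'M[R]_2) (x y z : R).

(* If [x] is fixed by [M], this is the eigenvalue of [M] on [(x, 1)]. *)
Definition mobius_den M x : R := M 1 0 * x + M 1 1.

Lemma fixed_pointP M x : \det M != 0 ->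
  fixed_point M x <-> M 0 0 * x + M 0 1 = x * mobius_den M x.
Proof.
rewrite /fixed_point /mobius det_mx22E => M_neq0; split=> [[den0]|Mx].
  by move=> /(canRL (divfK den0)).
have den0 : mobius_den M x != 0.
  apply: contra M_neq0 => /eqP den0; move: Mx; rewrite den0 mulr0 => num0.
  rewrite /mobius_den in den0; apply/eqP.
  have := congr1 ( *%R (M 0 0)) den0; have := congr1 ( *%R (M 1 0)) num0; lra.
by split=> //; exact: (canLR (mulfK den0)).
Qed.

Lemma fixed_point_eq M x :
  fixed_point M x -> M 0 0 * x + M 0 1 = x * mobius_den M x.
Proof. by move=> [den0 /(canRL (divfK den0))]. Qed.

Lemma mobius_den_neq0 M x : fixed_point M x -> mobius_den M x != 0.
Proof. by case. Qed.

Lemma mobius_denM M N x :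
  fixed_point N x -> mobius_den (M * N) x = mobius_den M x * mobius_den N x.
Proof.
move=> /fixed_point_eq Nx.
have := congr1 ( *%R (M 1 0)) Nx; rewrite /mobius_den !mul_mx22E; lra.
Qed.

Lemma fixed_pointM M N x :
  fixed_point M x -> fixed_point N x -> fixed_point (M * N) x.
Proof.
move=> Mx Nx; have den := mobius_denM M Nx.
have den_neq0 : mobius_den (M * N) x != 0.
  by rewrite den mulf_neq0 // mobius_den_neq0.
split=> //; apply: (canLR (mulfK den_neq0)).
rewrite den mulrA -(fixed_point_eq Mx) !mul_mx22E.
move/fixed_point_eq: Nx => Nx.
by have := congr1 ( *%R (M 0 0)) Nx; rewrite /mobius_den; lra.
Qed.

Lemma fixed_pointV M x : \det M = 1 -> fixed_point M x -> fixed_point M^-1 x.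
Proof.
move=> M1 /fixed_point_eq Mx; apply/fixed_pointP.
  by rewrite det_inv M1 invr1 oner_neq0.
by move: Mx; rewrite /mobius_den !inv_mx22E //; lra.
Qed.

Lemma mobius_den_inv M x : \det M = 1 -> fixed_point M x ->
  (mobius_den M x)^-1 = M 0 0 - x * M 1 0.
Proof.
rewrite det_mx22E => M1 Mx; have den_neq0 := mobius_den_neq0 Mx.
apply: (mulfI den_neq0); rewrite divff //; move/fixed_point_eq: Mx.
by move=> /(congr1 ( *%R (M 1 0))); rewrite /mobius_den; lra.
Qed.

Lemma fixed_point_vieta M x y : fixed_point M x -> fixed_point M y -> x != y ->
  M 0 0 - M 1 1 = M 1 0 * (x + y) /\ M 0 1 = - M 1 0 * (x * y).
Proof.
move=> /fixed_point_eq Mx /fixed_point_eq My xy.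
rewrite /mobius_den in Mx My; have xy0 : x - y != 0 by rewrite subr_eq0.
have sumE : M 0 0 - M 1 1 = M 1 0 * (x + y) by apply: (mulIf xy0); lra.
by split=> //; have := congr1 ( *%R x) sumE; lra.
Qed.

Lemma mobius_den_other M x y : \det M = 1 ->
  fixed_point M x -> fixed_point M y -> x != y ->
  mobius_den M y = (mobius_den M x)^-1.
Proof.
move=> M1 Mx My xy; rewrite mobius_den_inv //.
by have [sumE _] := fixed_point_vieta Mx My xy; rewrite /mobius_den; lra.
Qed.

Lemma hyperbolic_den_sq_neq1 M x : \det M = 1 -> hyperbolic M ->
  fixed_point M x -> mobius_den M x ^+ 2 != 1.
Proof.
move=> M1 hM Mx; apply/eqP => den2; move: hM; rewrite /hyperbolic.
have -> : \tr M = mobius_den M x + (mobius_den M x)^-1.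
  by rewrite mobius_den_inv // tr_mx22E /mobius_den; lra.
have -> : (mobius_den M x)^-1 = mobius_den M x.
  apply: (mulfI (mobius_den_neq0 Mx)).
  by rewrite divff ?mobius_den_neq0 // -expr2.
move/eqP: den2; rewrite sqr_norm_eq1 => /eqP den1.
by rewrite -mulr2n normrMn den1 ltxx.
Qed.

Lemma hyperbolic_entry10_neq0 M x y : \det M = 1 -> hyperbolic M ->
  fixed_point M x -> fixed_point M y -> x != y -> M 1 0 != 0.
Proof.
move=> M1 hM Mx My xy.
apply: contra (hyperbolic_den_sq_neq1 M1 hM Mx) => /eqP c0.
have den_xy : mobius_den M y = mobius_den M x by rewrite /mobius_den c0 !mul0r.
rewrite expr2 -{2}den_xy (mobius_den_other M1 Mx My) ?divff //.
exact: mobius_den_neq0.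
Qed.

Lemma hyperbolic_fixed_points M x y z : \det M = 1 -> hyperbolic M ->
  fixed_point M x -> fixed_point M y -> x != y -> fixed_point M z ->
  z = x \/ z = y.
Proof.
move=> M1 hM Mx My xy /fixed_point_eq Mz.
have [sumE prodE] := fixed_point_vieta Mx My xy.
have : M 1 0 * ((z - x) * (z - y)) = 0.
  have := congr1 ( *%R z) sumE; move: Mz; rewrite /mobius_den; lra.
move/eqP; rewrite mulf_eq0 (negPf (hyperbolic_entry10_neq0 M1 hM Mx My xy)) /=.
by rewrite mulf_eq0 !subr_eq0 => /orP[] /eqP ->; [left|right].
Qed.

Lemma comm_fixed_point M N x y : \det M = 1 -> \det N = 1 -> hyperbolic N ->
  M * N = N * M -> fixed_point N x -> fixed_point N y -> x != y ->
  fixed_point M y.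
Proof.
move=> M1 N1 hN /matrixP MN Nx Ny xy.
apply/fixed_pointP; first by rewrite M1 oner_neq0.
apply: (mulfI (hyperbolic_entry10_neq0 N1 hN Nx Ny xy)).
have := MN 0 0; have := MN 1 0; rewrite !mul_mx22E => MN10 MN00.
have := congr1 ( *%R (M 1 0)) (fixed_point_eq Ny); have := congr1 ( *%R y) MN10.
by rewrite /mobius_den; lra.
Qed.

Lemma derive1_mobius M x : mobius_den M x != 0 ->
  derive1 (mobius M) x = \det M / mobius_den M x ^+ 2.
Proof.
move=> den_neq0; rewrite derive1E.
have daffine (a b : R) : is_derive x 1 (fun z : R => a * z + b) a.
  have -> : (fun z : R => a * z + b) = (a *: (id : R -> R) + cst b).
    by apply/funext => z; rewrite /= !fctE.
  have := is_deriveD (is_deriveZ a (is_derive_id x (1 : R)))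
                     (is_derive_cst b x (1 : R)).
  by rewrite addr0 /GRing.scale /= mulr1.
have dden : is_derive x 1 (mobius_den M) (M 1 0) := daffine (M 1 0) (M 1 1).
have dnum := daffine (M 0 0) (M 0 1).
have /@derive_val := is_deriveM dnum (is_deriveV den_neq0 dden).
have -> : (fun z : R => M 0 0 * z + M 0 1) * (fun z : R => (mobius_den M z)^-1)
   = mobius M by apply/funext.
rewrite /mobius_den in den_neq0 * => ->.
by rewrite /GRing.scale /= det_mx22E; field.
Qed.

Lemma attractingP M x : \det M = 1 ->
  attracting M x <-> fixed_point M x /\ 1 < mobius_den M x ^+ 2.
Proof.
move=> M1; rewrite /attracting.
have norm_derive : fixed_point M x ->
    (`|derive1 (mobius M) x| < 1) = (1 < mobius_den M x ^+ 2).
  move=> /mobius_den_neq0 den_neq0.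
  have den2 : 0 < mobius_den M x ^+ 2 by rewrite exprn_even_gt0.
  by rewrite derive1_mobius // M1 mul1r gtr0_norm ?invr_gt0 // invf_lt1.
by split=> -[Mx]; rewrite norm_derive.
Qed.

Lemma mobius_heckeT x : mobius (heckeT R) x = - x^-1.
Proof. by rewrite /mobius !mx2E mul0r add0r mul1r addr0 mulN1r. Qed.

Lemma mobius_heckeT_gt0 x : (0 < mobius (heckeT R) x) = (x < 0).
Proof. by rewrite mobius_heckeT oppr_gt0 invr_lt0. Qed.

Lemma mobius_heckeT_lt0 x : (mobius (heckeT R) x < 0) = (0 < x).
Proof. by rewrite mobius_heckeT oppr_lt0 invr_gt0. Qed.

Lemma fixed_point_trmx M x : \det M != 0 -> x != 0 -> fixed_point M x ->
  fixed_point M^T (mobius (heckeT R) x).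
Proof.
move=> M_neq0 x0 /fixed_point_eq Mx; rewrite mobius_heckeT.
apply/fixed_pointP; first by rewrite det_tr.
apply: (mulfI (expf_neq0 2 x0)); move: Mx; rewrite /mobius_den !mxE => Mx.
have -> : x ^+ 2 * (M 0 0 * - x^-1 + M 1 0) = x ^+ 2 * M 1 0 - M 0 0 * x.
  by field.
have -> : x ^+ 2 * (- x^-1 * (M 0 1 * - x^-1 + M 1 1)) = M 0 1 - M 1 1 * x.
  by field.
by lra.
Qed.

End FixedPoints.

Section PositiveMatrices.
Variable R : realType.
Implicit Types (M : 'M[R]_2) (x y : R).

Local Notation mobT := (mobius (heckeT R)).

Lemma fixed_points_posmx M x y : \det M = 1 -> 0 < \tr M ->
    fixed_point M x -> fixed_point M y -> y < 0 < x ->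
  1 < mobius_den M x ^+ 2 -> posmx M.
Proof.
move=> M1 tM Mx My /andP[y0 x0] den2; have yx : y < x := lt_trans y0 x0.
have xy : x != y by rewrite gt_eqF.
have [sumE prodE] := fixed_point_vieta Mx My xy.
have den_y := mobius_den_other M1 Mx My xy.
have trE : \tr M = mobius_den M x + mobius_den M y.
  by rewrite tr_mx22E /mobius_den; lra.
have den_x0 : 0 < mobius_den M x.
  rewrite ltNge; apply/negP => den_le0; move: tM; rewrite trE den_y.
  by have : (mobius_den M x)^-1 <= 0; [rewrite invr_le0|lra].
have den_x1 : 1 < mobius_den M x by rewrite expr_gt1 // ltW in den2.
have den_y0 : 0 < mobius_den M y by rewrite den_y invr_gt0.
have den_y1 : mobius_den M y < 1 by rewrite den_y invf_lt1.
have c0 : 0 < M 1 0.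
  have : 0 < M 1 0 * (x - y) by move: den_x1 den_y1; rewrite /mobius_den; lra.
  by rewrite pmulr_lgt0 // subr_gt0.
have cx := mulr_gt0 c0 x0; have cy : M 1 0 * y < 0 by rewrite pmulr_rlt0.
apply/posmx22P; split=> //; rewrite /mobius_den in den_y0; try lra.
by rewrite prodE mulNr -mulrN mulr_gt0 // oppr_gt0 pmulr_rlt0.
Qed.

Lemma posmx_den_gt1 M x : \det M = 1 -> posmx M -> fixed_point M x -> 0 < x ->
  1 < mobius_den M x ^+ 2.
Proof.
rewrite det_mx22E => M1 /posmx22P[a0 b0 c0 d0] /fixed_point_eq Mx x0.
have d_lt : M 1 1 < mobius_den M x by rewrite /mobius_den ltrDr mulr_gt0.
have a_lt : M 0 0 < mobius_den M x by rewrite -(ltr_pM2r x0); lra.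
have := ltr_pM (ltW a0) (ltW d0) a_lt d_lt; rewrite -expr2.
by have := mulr_gt0 b0 c0; lra.
Qed.

Lemma posmx_fixed_point_uniq M x y : posmx M ->
  fixed_point M x -> fixed_point M y -> 0 < x -> 0 < y -> x = y.
Proof.
move=> /posmx22P[_ b0 c0 _] Mx My x0 y0; apply/eqP; apply: contraT => xy.
have [_ bE] := fixed_point_vieta Mx My xy.
by have := mulr_gt0 c0 (mulr_gt0 x0 y0); lra.
Qed.

Definition pos_root M : R :=
  (M 0 0 - M 1 1 + Num.sqrt ((M 0 0 - M 1 1) ^+ 2 + 4 * (M 0 1 * M 1 0))) /
  (2 * M 1 0).

Let posmx_sqrt M (D := (M 0 0 - M 1 1) ^+ 2 + 4 * (M 0 1 * M 1 0)) :
  posmx M -> Num.sqrt D ^+ 2 = D /\ `|M 0 0 - M 1 1| < Num.sqrt D.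
Proof.
move=> /posmx22P[_ b0 c0 _]; have bc := mulr_gt0 b0 c0.
have D_ge0 : 0 <= D by have := sqr_ge0 (M 0 0 - M 1 1); rewrite /D; lra.
split; first exact: sqr_sqrtr.
rewrite -(@ltr_pXn2r _ 2) ?nnegrE ?sqrtr_ge0 // real_normK ?num_real //.
by rewrite sqr_sqrtr // /D; lra.
Qed.

Lemma pos_root_gt0 M : posmx M -> 0 < pos_root M.
Proof.
move=> M0; have [_] := posmx_sqrt M0; have /posmx22P[_ _ c0 _] := M0.
by rewrite ltr_norml => /andP[? _]; rewrite divr_gt0 ?mulr_gt0 //; lra.
Qed.

Lemma pos_root_fixed M : posmx M -> fixed_point M (pos_root M).
Proof.
move=> M0; have [r2 _] := posmx_sqrt M0; have x0 := pos_root_gt0 M0.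
have /posmx22P[_ _ c0 d0] := M0; have c_neq0 := lt0r_neq0 c0.
have den_neq0 : mobius_den M (pos_root M) != 0.
  by rewrite lt0r_neq0 // addr_gt0 // mulr_gt0.
split=> //; apply: (canLR (mulfK den_neq0)).
rewrite /mobius_den /pos_root; move: (Num.sqrt _) r2 => r r2.
apply/eqP; rewrite -subr_eq0; apply/eqP.
pose D := (M 0 0 - M 1 1) ^+ 2 + 4 * (M 0 1 * M 1 0).
transitivity ((D - r ^+ 2) / (4 * M 1 0)); first by rewrite /D; field.
by rewrite r2 subrr mul0r.
Qed.

Lemma pos_rootP M x : posmx M -> fixed_point M x -> 0 < x -> x = pos_root M.
Proof.
move=> M0 Mx x0; apply: (posmx_fixed_point_uniq M0 Mx) => //.
  exact: pos_root_fixed.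
exact: pos_root_gt0.
Qed.

Lemma pos_root_trmx_fixed M : \det M = 1 -> posmx M ->
  fixed_point M (mobT (pos_root M^T)).
Proof.
move=> M1 M0; have MT0 := posmx_trmx M0; rewrite -{1}[M]trmxK.
apply: fixed_point_trmx; rewrite ?det_tr ?M1 ?oner_neq0 //.
  by rewrite lt0r_neq0 // pos_root_gt0.
exact: pos_root_fixed.
Qed.

Lemma pos_root_neq_trmx M : posmx M -> pos_root M != mobT (pos_root M^T).
Proof.
move=> M0; rewrite gt_eqF // (@lt_trans _ _ 0) ?pos_root_gt0 //.
by rewrite mobius_heckeT_lt0 pos_root_gt0 //; exact: posmx_trmx.
Qed.

Lemma attracting_pos_root M :
  \det M = 1 -> posmx M -> attracting M (pos_root M).
Proof.
move=> M1 M0; apply/attractingP => //; split; first exact: pos_root_fixed.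
by apply: posmx_den_gt1; rewrite ?pos_root_gt0 //; exact: pos_root_fixed.
Qed.

End PositiveMatrices.

Section Shears.
Variable R : realType.
Implicit Types (M : 'M[R]_2) (x t : R).

(* [1 + t (x, 1)^T (1, - x)], a unipotent matrix fixing [x]. *)
Definition shear x t : 'M[R]_2 :=
  mx2 (1 + t * x) (- (t * x ^+ 2)) t (1 - t * x).

Lemma shear_inj x : injective (shear x).
Proof. by move=> t t' /matrixP/(_ 1 0); rewrite !mx2E. Qed.

Lemma shear0 x : shear x 0 = 1.
Proof. by apply: eq_mx22; rewrite mx2E one_mx22E; ring. Qed.

Lemma shearP M x : \det M = 1 -> fixed_point M x -> mobius_den M x = 1 ->
  M = shear x (M 1 0).
Proof.
move=> M1 Mx den1; have := mobius_den_inv M1 Mx; move/fixed_point_eq: Mx.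
rewrite den1 invr1; move: den1; rewrite /mobius_den => den1 Mx1 aE.
have aEx := congr1 ( *%R x) aE.
by apply: eq_mx22; rewrite mx2E //; lra.
Qed.

Lemma mul_shear M x t : \det M = 1 -> fixed_point M x ->
  M * shear x t = shear x (t * mobius_den M x ^+ 2) * M.
Proof.
move=> M1 Mx; have := mobius_den_inv M1 Mx; have := mobius_den_neq0 Mx.
move/fixed_point_eq: Mx; set m := mobius_den M x => Mx m0 mV.
have dE : M 1 1 = m - M 1 0 * x by rewrite /m /mobius_den; ring.
have aE : M 0 0 = m^-1 + x * M 1 0 by rewrite mV; ring.
have bE : M 0 1 = x * m - M 0 0 * x by rewrite -Mx; ring.
by apply: eq_mx22; rewrite !mul_mx22E !mx2E ?dE ?bE ?aE; field.
Qed.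

Lemma expr_mul_shear M x t k : \det M = 1 -> fixed_point M x ->
  M ^+ k * shear x t = shear x (t * (mobius_den M x ^+ 2) ^+ k) * M ^+ k.
Proof.
move=> M1 Mx; elim: k => [|k ih]; first by rewrite !expr0 !mulr1 mul1r.
by rewrite exprS [(_ ^+ 2) ^+ _]exprSr -mulrA ih mulrA mul_shear // !mulrA.
Qed.

End Shears.

Section CommonFixedPoint.
Variables (R : realType) (p : nat).
Hypothesis p_ge3 : (3 <= p)%N.
Implicit Types (M N : 'M[R]_2) (x y t : R).

Lemma heckeG_shear_small x t :
  heckeG p (shear x t) -> `|t| * (x ^+ 2 + 1 + `|x|) < 1 -> t = 0.
Proof.
move=> Gt small; have := mulr_ge0 (normr_ge0 t) (normr_ge0 x).
have := mulr_ge0 (normr_ge0 t) (sqr_ge0 x); have := normr_ge0 t => t0 tx2 tx.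
have /(heckeG_discrete p_ge3 Gt)[shear1|/matrixP/(_ 0 0)] :
    `|shear x t 0 1| + `|shear x t 1 0| < 1.
- by rewrite !mx2E normrN normrM (ger0_norm (sqr_ge0 x)); lra.
- by apply: (@shear_inj R x); rewrite shear0.
- rewrite opp_mxE mx2E one_mx22E => tx1.
  by have := ler_norm (- (t * x)); rewrite normrN normrM; lra.
Qed.

(* Conjugating the shear by powers of [M] contracts it to the identity. *)
Lemma expanding_shear_eq0 M x t : heckeG p M -> fixed_point M x ->
  1 < mobius_den M x ^+ 2 -> heckeG p (shear x t) -> t = 0.
Proof.
move=> GM Mx den1 Gt; have M1 := heckeG_det GM; set q := _ ^+ 2 in den1.
have q0 : 0 < q by exact: lt_trans den1.
pose B := x ^+ 2 + 1 + `|x|.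
have qV1 : `|q^-1| < 1 by rewrite gtr0_norm ?invr_gt0 // invf_lt1.
have [k small] : exists k, `|t * B * q^-1 ^+ k| < 1.
  have /cvgr0_norm_lt/(_ 1 ltr01) := cvg_geometric (t * B) qV1.
  by move=> /filter_ex.
have /heckeG_shear_small tk0 : heckeG p (shear x (t * q^-1 ^+ k)).
  have Mk := heckeGX k GM; have Mku := heckeG_unit Mk.
  suff -> : shear x (t * q^-1 ^+ k) = (M ^+ k)^-1 * shear x t * M ^+ k.
    exact: heckeGM (heckeGM (heckeGV Mk) Gt) Mk.
  apply: (mulrI Mku); rewrite expr_mul_shear // mulrA mulVKr //.
  by rewrite -/q -mulrA -exprMn mulVf ?lt0r_neq0 // expr1n mulr1.
have /eqP : t * q^-1 ^+ k = 0.
  apply: tk0; apply: le_lt_trans small.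
  have B0 : 0 <= B by rewrite /B; have := sqr_ge0 x; have := normr_ge0 x; lra.
  by rewrite -/B mulrAC [leRHS]normrM (ger0_norm B0).
by rewrite mulf_eq0 expf_eq0 invr_eq0 (gt_eqF q0) andbF orbF => /eqP.
Qed.

Lemma hyperbolic_shear_eq0 M x t : heckeG p M -> hyperbolic M ->
  fixed_point M x -> heckeG p (shear x t) -> t = 0.
Proof.
move=> GM hM Mx Gt; have M1 := heckeG_det GM.
have := hyperbolic_den_sq_neq1 M1 hM Mx; rewrite neq_lt => /orP[den1|den1].
  have MVx := fixed_pointV M1 Mx.
  apply: (expanding_shear_eq0 (heckeGV GM) MVx) Gt.
  have -> : mobius_den M^-1 x = (mobius_den M x)^-1.
    apply: (mulIf (mobius_den_neq0 Mx)); rewrite -mobius_denM //.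
    rewrite mulVf ?mobius_den_neq0 // mulVr ?(heckeG_unit GM) //.
    by rewrite /mobius_den !one_mx22E mul0r add0r.
  by rewrite exprVn invf_gt1 // exprn_even_gt0 // mobius_den_neq0.
exact: (expanding_shear_eq0 GM Mx den1 Gt).
Qed.

(* The commutator of [M] and [N] is a shear. *)
Lemma heckeG_hyperbolic_comm M N x : heckeG p M -> heckeG p N ->
  hyperbolic M -> fixed_point M x -> fixed_point N x -> M * N = N * M.
Proof.
move=> GM GN hM Mx Nx; have GNM := heckeGM GN GM; have NM1 := heckeG_det GNM.
have NMx := fixed_pointM Nx Mx; pose K := M * N * (N * M)^-1.
have GK : heckeG p K := heckeGM (heckeGM GM GN) (heckeGV GNM).
have KNM : K * (N * M) = M * N by rewrite /K divrK // (heckeG_unit GNM).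
have Kx : fixed_point K x.
  exact: fixed_pointM (fixed_pointM Mx Nx) (fixed_pointV NM1 NMx).
have den1 : mobius_den K x = 1.
  apply: (mulIf (mobius_den_neq0 NMx)); rewrite -mobius_denM // KNM mul1r.
  by rewrite !mobius_denM // mulrC.
have KE := shearP (heckeG_det GK) Kx den1.
have K10 : K 1 0 = 0 by apply: (hyperbolic_shear_eq0 GM hM Mx); rewrite -KE.
by rewrite -KNM KE K10 shear0 mul1r.
Qed.

Lemma hconj_fixed_point M x y : heckeG p M -> hyperbolic M ->
  fixed_point M x -> hconj p x y -> fixed_point M y.
Proof.
move=> GM hM Mx [N [GN hN Nx Ny /nesym/eqP xy]].
have MN := heckeG_hyperbolic_comm GM GN hM Mx Nx.
exact: comm_fixed_point (heckeG_det GM) (heckeG_det GN) hN MN Nx Ny xy.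
Qed.

Lemma hconjP M x y z : heckeG p M -> hyperbolic M ->
  fixed_point M x -> fixed_point M y -> x != y -> hconj p x z <-> z = y.
Proof.
move=> GM hM Mx My xy; split=> [xz|->]; last first.
  by exists M; split=> //; exact/nesym/eqP.
have Mz := hconj_fixed_point GM hM Mx xz; have [_ [_ _ _ _ zx]] := xz.
by have [] := hyperbolic_fixed_points (heckeG_det GM) hM Mx My xy Mz.
Qed.

Lemma comm_Vprod_power u v : Vword p u -> Vword p v ->
    Vprod R p u * Vprod R p v = Vprod R p v * Vprod R p u ->
  exists w i j,
    Vprod R p u = Vprod R p w ^+ i /\ Vprod R p v = Vprod R p w ^+ j.
Proof.
move=> up vp uv; have /cat_comm_power[w [i [j [-> ->]]]] : u ++ v = v ++ u.
  exact: Vprod_cat_inj uv.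
by exists w, i, j; rewrite !Vprod_flatten_nseq.
Qed.

Lemma prim_hyp_pos_root_inj M N : prim_hyp p M -> prim_hyp p N ->
  posmx M -> posmx N -> pos_root M = pos_root N -> M = N.
Proof.
move=> [GM _ hM pM] [GN _ hN pN] M0 N0 MN.
have Mx := pos_root_fixed M0; have := pos_root_fixed N0; rewrite -MN => Nx.
have := heckeG_hyperbolic_comm GM GN hM Mx Nx.
have [u up Mu] := heckeG_posmx_Vprod (ltnW p_ge3) GM M0.
have [v vp Nv] := heckeG_posmx_Vprod (ltnW p_ge3) GN N0.
rewrite Mu Nv => /(comm_Vprod_power up vp)[w [i [j [ui vj]]]].
have Gw := heckeG_Vprod R p w.
rewrite Mu ui in hM pM; rewrite Nv vj in hN pN.
by rewrite ui vj (primitive_exp_eq1 Gw hM pM) (primitive_exp_eq1 Gw hN pN).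
Qed.

End CommonFixedPoint.

Section Forms.
Variables (R : realType) (p : nat).
Implicit Types (M N g h : 'M[R]_2) (Q : bqf R) (A : set (bqf R)).

Lemma Zlambda_int (n : int) : Zlambda p (n%:~R : R).
Proof. by exists n%:P; rewrite map_polyC hornerC. Qed.

Lemma ZlambdaD (a b : R) : Zlambda p a -> Zlambda p b -> Zlambda p (a + b).
Proof. by move=> [q ->] [r ->]; exists (q + r); rewrite rmorphD hornerD. Qed.

Lemma ZlambdaN (a : R) : Zlambda p a -> Zlambda p (- a).
Proof. by move=> [q ->]; exists (- q); rewrite rmorphN hornerN. Qed.

Lemma ZlambdaM (a b : R) : Zlambda p a -> Zlambda p b -> Zlambda p (a * b).
Proof. by move=> [q ->] [r ->]; exists (q * r); rewrite rmorphM hornerM. Qed.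

Lemma Zlambda_lambda : Zlambda p (lambda R p).
Proof. by exists 'X; rewrite map_polyX hornerX. Qed.

Lemma heckeG_Zlambda M : heckeG p M -> forall i j, Zlambda p (M i j).
Proof.
have Z0 := Zlambda_int 0; have Z1 := Zlambda_int 1; have Zl := Zlambda_lambda.
have ZN1 := Zlambda_int (-1).
elim=> {M} [|||M N _ ZM _ ZN|M GM ZM].
- by do 2![apply: ord2_ind]; rewrite !mx2E.
- by do 2![apply: ord2_ind]; rewrite !mx2E.
- by do 2![apply: ord2_ind]; rewrite one_mx22E.
- by move=> i j; rewrite mul_mx22E; apply: ZlambdaD; exact: ZlambdaM.
- have M1 := heckeG_det GM; rewrite -[invmx M]/(M^-1).
  by do 2![apply: ord2_ind]; rewrite inv_mx22E //; exact: ZlambdaN.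
Qed.

Lemma lambda_bqf_act Q g :
  lambda_bqf p Q -> heckeG p g -> lambda_bqf p (bqf_act Q g).
Proof.
case: Q => a b c [/= Za Zb Zc] /heckeG_Zlambda Zg.
have Z2 : Zlambda p (2 : R) := Zlambda_int 2.
by split; rewrite /= ?expr2;
  do !(exact: Zg || assumption || apply: ZlambdaD || apply: ZlambdaM).
Qed.

Lemma bqf_act1 Q : bqf_act Q 1 = Q.
Proof. by case: Q => a b c; rewrite /bqf_act !one_mx22E; congr BQF; ring. Qed.

Lemma bqf_actM Q g h : bqf_act (bqf_act Q g) h = bqf_act Q (g * h).
Proof. by case: Q => a b c; rewrite /bqf_act !mul_mx22E; congr BQF; ring. Qed.

Lemma bqf_act_of_mx M g : \det g = 1 ->
  bqf_act (bqf_of_mx M) g = bqf_of_mx (g^-1 * M * g).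
Proof.
by move=> g1; rewrite /bqf_of_mx !mul_mx22E !inv_mx22E //; congr BQF; ring.
Qed.

(* The form determines the square of the trace, as
   (a + d)^2 = (d - a)^2 + 4 b c + 4. *)
Lemma bqf_of_mx_inj M N : \det M = 1 -> \det N = 1 -> 0 < \tr M -> 0 < \tr N ->
  bqf_of_mx M = bqf_of_mx N -> M = N.
Proof.
rewrite !det_mx22E !tr_mx22E => M1 N1 tM tN [h10 hd /oppr_inj h01].
have trE : M 0 0 + M 1 1 = N 0 0 + N 1 1.
  apply/eqP; rewrite -(@eqrXn2 _ 2) // ?ltW //; apply/eqP.
  rewrite h10 h01 in M1.
  by have := congr1 (fun z => z ^+ 2) hd; lra.
by apply: eq_mx22; rewrite ?h10 ?h01 //; lra.
Qed.

Lemma bqf_equiv_sym Q Q' : bqf_equiv p Q Q' -> bqf_equiv p Q' Q.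
Proof.
move=> [g Gg ->]; exists g^-1; first exact: heckeGV.
by rewrite bqf_actM divrr ?(heckeG_unit Gg) // bqf_act1.
Qed.

Lemma bqf_equiv_trans Q1 Q2 Q3 :
  bqf_equiv p Q1 Q2 -> bqf_equiv p Q2 Q3 -> bqf_equiv p Q1 Q3.
Proof.
move=> [g Gg ->] [h Gh ->]; exists (g * h); first exact: heckeGM.
by rewrite bqf_actM.
Qed.

Lemma bqf_class_equiv A Q Q' :
  bqf_class p A -> A Q -> A Q' <-> bqf_equiv p Q Q'.
Proof.
move=> [Q0 _ ->] [ZQ Q0Q]; split=> [[_ Q0Q']|QQ'].
  exact: bqf_equiv_trans (bqf_equiv_sym Q0Q) Q0Q'.
split; last exact: bqf_equiv_trans Q0Q QQ'.
by case: QQ' => g Gg ->; exact: lambda_bqf_act.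
Qed.

Lemma bqf_equiv_of_mx M N :
    heckeG p M -> heckeG p N -> 0 < \tr M -> 0 < \tr N ->
  bqf_equiv p (bqf_of_mx M) (bqf_of_mx N) <-> hecke_conjugate p M N.
Proof.
move=> GM GN tM tN; rewrite hecke_conjugateP //.
split=> -[g Gg NE]; exists g => //.
  have Gc : heckeG p (g^-1 * M * g).
    exact: heckeGM (heckeGM (heckeGV Gg) GM) Gg.
  apply: bqf_of_mx_inj (heckeG_det GN) (heckeG_det Gc) tN _ _.
    by rewrite mxtrace_conj ?(heckeG_unit Gg).
  by rewrite NE bqf_act_of_mx // (heckeG_det Gg).
by rewrite NE bqf_act_of_mx // (heckeG_det Gg).
Qed.

Lemma bqf_class_conjugate A M N :
    bqf_class p A -> prim_hyp p M -> prim_hyp p N -> A (bqf_of_mx M) ->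
  A (bqf_of_mx N) <-> hecke_conjugate p M N.
Proof.
move=> clA [GM tM _ _] [GN tN _ _] AM; rewrite -bqf_equiv_of_mx //.
exact: bqf_class_equiv.
Qed.

End Forms.

Section Poles.
Variables (R : realType) (p : nat).
Hypothesis p_ge3 : (3 <= p)%N.
Implicit Types (M W : 'M[R]_2) (x z : R) (A : set (bqf R)) (X : set R).

Local Notation mobT := (mobius (heckeT R)).

Definition reduced A : set 'M[R]_2 :=
  [set M | [/\ prim_hyp p M, A (bqf_of_mx M) & posmx M]].

Lemma hconj_pos_root M z : prim_hyp p M -> posmx M ->
  hconj p (pos_root M) z <-> z = mobT (pos_root M^T).
Proof.
move=> [GM _ hM _] M0; have My := pos_root_trmx_fixed (heckeG_det GM) M0.
exact: (hconjP p_ge3 z GM hM (pos_root_fixed M0) My (pos_root_neq_trmx M0)).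
Qed.

Lemma hconj_heckeT_pos_root M z : prim_hyp p M -> posmx M ->
  hconj p (mobT (pos_root M)) z <-> z = pos_root M^T.
Proof.
move=> pM M0; have [GT _ hT _] := prim_hyp_trmx pM; have MT0 := posmx_trmx M0.
have := pos_root_trmx_fixed (heckeG_det GT) MT0; have := pos_root_neq_trmx MT0.
rewrite trmxK eq_sym => xy Mx.
exact: (hconjP p_ge3 z GT hT Mx (pos_root_fixed MT0) xy).
Qed.

Lemma simple_pos_root M : prim_hyp p M -> posmx M -> simple p (pos_root M).
Proof.
move=> pM M0; exists (mobT (pos_root M^T)); first exact/hconj_pos_root.
by rewrite mobius_heckeT_lt0 !pos_root_gt0 //; exact: posmx_trmx.
Qed.

Lemma Malpha_simple_pos_root M x :
  Malpha p x M -> simple p x -> posmx M /\ x = pos_root M.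
Proof.
move=> [[GM tM hM pM] aM] [y xy yx]; have M1 := heckeG_det GM.
have [Mx den1] := (attractingP x M1).1 aM.
have My := hconj_fixed_point p_ge3 GM hM Mx xy.
have M0 := fixed_points_posmx M1 tM Mx My yx den1.
by split=> //; apply: pos_rootP => //; case/andP: yx.
Qed.

Lemma ZsetE A : Zset p A = @pos_root R @` reduced A.
Proof.
apply/seteqP; split=> [x [sx [Q [M Mx ->] AM]]|_ [M [pM AM M0] <-]].
  have [M0 ->] := Malpha_simple_pos_root Mx sx.
  by exists M => //; split=> //; case: Mx.
split; first exact: simple_pos_root.
exists (bqf_of_mx M) => //; exists M => //; split=> //.
by case: pM => /heckeG_det M1 _ _ _; exact: attracting_pos_root.
Qed.

Lemma MsetE A : Mset p A = reduced A.
Proof.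
apply/seteqP; split=> [M [x]|M rM].
  rewrite ZsetE => -[N [pN AN N0] <-] MN; have pM := MN.1.
  have [M0 NM] := Malpha_simple_pos_root MN (simple_pos_root pN N0).
  by rewrite (prim_hyp_pos_root_inj p_ge3 pM pN M0 N0 (esym NM)).
have [pM AM M0] := rM; exists (pos_root M); first by rewrite ZsetE; exists M.
by split=> //; case: pM => /heckeG_det M1 _ _ _; exact: attracting_pos_root.
Qed.

Definition heckeT_closure X : set R := X `|` mobT @` X.

Lemma heckeT_closure_gt0 X :
  X `<=` [set x | 0 < x] -> heckeT_closure X `&` [set x | 0 < x] = X.
Proof.
move=> X0; apply/seteqP; split=> [x [[//|[y /X0/= y0 <-]]]|x Xx] /=.
  by rewrite mobius_heckeT_gt0 lt_gtF.
by split; [left|exact: X0].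
Qed.

Lemma ISPE A : ISP p A = heckeT_closure (@pos_root R @` reduced A).
Proof. by rewrite -ZsetE. Qed.

Lemma hconj_ISPE A : hconj_set p (ISP p A) =
  heckeT_closure (@pos_root R @` (trmx @` reduced A)).
Proof.
rewrite ISPE; apply/seteqP; split=> z.
  move=> [_ [[M rM <-]|[_ [M rM <-] <-]]]; have [pM _ M0] := rM.
    move=> /(hconj_pos_root _ pM M0) ->; right.
    by exists (pos_root M^T) => //; exists M^T => //; exists M.
  move=> /(hconj_heckeT_pos_root _ pM M0) ->; left.
  by exists M^T => //; exists M.
move=> [[_ [M rM <-] <-]|[_ [_ [M rM <-] <-] <-]]; have [pM _ M0] := rM.
  exists (mobT (pos_root M)); last exact/hconj_heckeT_pos_root.
  by right; exists (pos_root M) => //; exists M.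
by exists (pos_root M); [left; exists M|exact/hconj_pos_root].
Qed.

Lemma hecke_symmetricP A : hconj_set p (ISP p A) = ISP p A <->
  trmx @` Mset p A = Mset p A.
Proof.
rewrite hconj_ISPE ISPE MsetE; split=> [|-> //].
have red_pos : reduced A `<=` [set M | prim_hyp p M /\ posmx M].
  by move=> M [].
have red_trmx : trmx @` reduced A `<=` [set M | prim_hyp p M /\ posmx M].
  by move=> _ [M [pM _ M0] <-]; split; [exact: prim_hyp_trmx|exact: posmx_trmx].
have roots_gt0 (X : set 'M[R]_2) : X `<=` [set M | prim_hyp p M /\ posmx M] ->
    @pos_root R @` X `<=` [set x | 0 < x].
  by move=> XD _ [M /XD[_ M0] <-]; exact: pos_root_gt0.
move=> /(congr1 (setI^~ [set x | 0 < x])).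
rewrite !heckeT_closure_gt0; try exact: roots_gt0.
apply: image_set_inj_on red_trmx red_pos => M N.
rewrite !inE => -[pM M0] [pN N0]; exact: (prim_hyp_pos_root_inj p_ge3).
Qed.

Lemma trmx_MsetP A W : bqf_class p A -> reduced A W ->
  trmx @` Mset p A = Mset p A <-> hecke_conjugate p W^T W.
Proof.
move=> clA [pW AW W0]; have pWT := prim_hyp_trmx pW.
rewrite MsetE; split=> [sym|WTW].
  have [_ AWT _] : reduced A W^T by rewrite -sym; exists W.
  exact/(bqf_class_conjugate clA pWT pW AWT).
have red_trmx M : reduced A M -> reduced A M^T.
  move=> [pM AM M0]; have pMT := prim_hyp_trmx pM.
  split=> //; last exact: posmx_trmx.
  apply/(bqf_class_conjugate clA pW pMT AW).
  apply: hecke_conjugate_trans (hecke_conjugate_sym WTW) _.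
  exact/hecke_conjugate_trmx/(bqf_class_conjugate clA pW pM AW).
apply/seteqP; split=> [_ [M /red_trmx rM <-] //|M rM].
by exists M^T; [exact: red_trmx|exact: trmxK].
Qed.

Lemma Vprod_reduced A js : Vword p js -> conj_class_of p A (Vprod R p js) ->
  reduced A (Vprod R p js).
Proof.
move=> jsp [M [WM pM AM]]; have W1 := ge1mx_Vprod R (ltnW p_ge3) jsp.
have [GM tM hM _] := pM.
have tW := tr_Vprod_gt0 R (ltnW p_ge3) jsp.
rewrite (projeq_tr_gt0 tW tM WM) in W1 *; split=> //.
exact: ge1mx_hyperbolic_posmx (heckeG_det GM) W1 hM.
Qed.

End Poles.

Theorem theorem4p8 (R : realType) (p : nat) (p_ge3 : (3 <= p)%N)
    (A : set (bqf R)) (A_hyp : hyperbolic_class p A)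
    (js : seq nat) (js_word : Vword p js)
    (W_class : conj_class_of p A (Vprod R p js)) :
  projeq (Vprod R p js)^T (Vprod R p (tr_word p js)) /\
  [<-> hconj_set p (ISP p A) = ISP p A;
       trmx @` Mset p A = Mset p A;
       hecke_conjugate p (Vprod R p js)^T (Vprod R p js);
       cyclic_perm (tr_word p js) js].
Proof.
have W_trmx := Vprod_trmx R (ltnW p_ge3) js_word.
split; first by left.
have sym_poles := hecke_symmetricP p_ge3 A.
have sym_Mset := trmx_MsetP p_ge3 A_hyp.1 (Vprod_reduced p_ge3 js_word W_class).
have sym_word := Vprod_conjP R p_ge3 (Vword_tr_word js_word) js_word.
rewrite -W_trmx in sym_word; tfae.
- exact: sym_poles.1.
- exact: sym_Mset.1.
- exact: sym_word.1.
- by move=> /sym_word.2/sym_Mset.2/sym_poles.2.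
Qed.
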